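(* Let $\mathcal U=(U_i)_{i\in I}$ be an open covering of a manifold $N$ and $\mathbf G\stackrel{\rho}{\to}\mathbf H$ a crossed module of Lie groups. Let $(\mathcal U,\bullet,\star)$ and $(\mathcal U,\bullet',\star')$ be two adapted Lie groupoid $\mathbf G\to\mathbf H$-extensions of the Čech groupoid $N[\mathcal U]$, and let $(\lambda,\mathbf g)$ and $(\lambda',\mathbf g')$ be their associated $\mathbf G\to\mathbf H$-valued non-Abelian $1$-cocycles. Then the following constructions define a one to one correspondence between the set of isomorphisms of Lie groupoid $\mathbf G\to\mathbf H$-extensions of $N[\mathcal U]$ from $(\mathcal U,\bullet,\star)$ to $(\mathcal U,\bullet',\star')$ and the set of $\mathbf G\to\mathbf H$-valued $1$-coboundaries relating $(\lambda,\mathbf g)$ and $(\lambda',\mathbf g')$: (1) To an isomorphism $(\Phi_{\mathcal R},\Phi_P)$ one associates $r_i:U_i\to\mathbf H$ and $\mathbf v_{ij}:U_{ij}\to\mathbf G$ defined by $(x_i,r_i)=\Phi_P(x_i,e)$ and $(\mathbf v_{ij}^{-1},x_{ij})=\Phi_{\mathcal R}(e,x_{ij})$. (2) To a $1$-coboundary $(r,\mathbf v)$ relating $(\lambda,\mathbf g)$ and $(\lambda',\mathbf g')$ one associates $\Phi_{\mathcal R}(g,x_{ij})=(r_i(g)\mathbf v_{ij}^{-1},x_{ij})$ for $i,j\in I$, $x\in U_{ij}$, $g\in\mathbf G$, and $\Phi_P(x_i,h)=(x_i,r_ih)$ for $i\in I$, $x\in U_i$, $h\in\mathbf H$.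
   Context: Crossed module of Lie groups: $(\mathbf G,\mathbf H,\rho,\jmath)$ with $\mathbf G,\mathbf H$ finite dimensional Lie groups and Lie group morphisms $\rho:\mathbf G\to\mathbf H$, $\jmath:\mathbf H\to\mathrm{Aut}(\mathbf G)$ such that, writing $h(g):=\jmath(h)(g)$, one has $\rho(h(g))=h\rho(g)h^{-1}$ and $\rho(g)(g')=gg'g^{-1}$. Neutral elements are denoted $e$. Lie groupoids $\Gamma\rightrightarrows M$ have source $s$, target $t$, unit $\epsilon$; the product $x\bullet x'$ is defined when $t(x)=s(x')$. A left action of $\Gamma\rightrightarrows M$ on $\pi:P\to M$: $\gamma\cdot p$ is defined when $t(\gamma)=\pi(p)$, with $\pi(\gamma\cdot p)=s(\gamma)$ and the usual axioms. An $\mathbf H$-principal bundle over $\Gamma\rightrightarrows M$ is a right $\mathbf H$-principal bundle $P\to M$ with a left $\Gamma$-action commuting with the $\mathbf H$-action. Čech groupoid: $U_{ij}=U_i\cap U_j$, etc.; $x_i$ (resp. $x_{ij}$) denotes $x$ viewed in the copy $U_i$ (resp. $U_{ij}$) of the disjoint union. $N[\mathcal U]$ is $\coprod_{i,j}U_{ij}\rightrightarrows\coprod_iU_i$ with $s(x_{ij})=x_i$, $t(x_{ij})=x_j$, $x_{ij}x_{jk}=x_{ik}$. Lie groupoid extension: a Lie groupoid morphism $\varphi:\mathcal R\to\mathcal G$ over the identity of a common base $M$ that is a surjective submersion. Its kernel is $K=\varphi^{-1}(\epsilon(M))$; it is a $\mathbf G$-extension if $K$ is a locally trivial bundle of groups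 with typical fibre $\mathbf G$. The band is $Band(\mathcal R\to\mathcal G)=\coprod_{m\in M}\mathrm{Isom}(\mathbf G,K_m)$, an $\mathrm{Aut}(\mathbf G)$-principal bundle over $M$ (right action by precomposition) and over $\mathcal R\rightrightarrows M$ through $(r\cdot b)(g)=r\,b(g)\,r^{-1}$. A $\mathbf G\to\mathbf H$-extension of $\mathcal G\rightrightarrows M$ is a triple $(\mathcal R\to\mathcal G,P\to M,\chi)$ with $\mathcal R\to\mathcal G$ a $\mathbf G$-extension, $P\to M$ an $\mathbf H$-principal bundle over $\mathcal R\rightrightarrows M$, and $\chi:P\to Band(\mathcal R\to\mathcal G)$ a smooth map over $\mathrm{id}_M$ with $\chi(r\cdot p\cdot h)=r\cdot\chi(p)\cdot\jmath(h)$, such that $p\cdot\rho(g)=\chi(p)(g)\cdot p$ for all $p\in P,g\in\mathbf G$. An isomorphism between two $\mathbf G\to\mathbf H$-extensions $(\mathcal R\stackrel{\varphi}{\to}\mathcal G,P,\chi)$ and $(\mathcal R'\stackrel{\varphi'}{\to}\mathcal G,P',\chi')$ of the same $\mathcal G\rightrightarrows M$ is a pair $(\Phi,\Psi)$, $\Phi:\mathcal R\to\mathcal R'$ a Lie groupoid isomorphism with $\varphi'\circ\Phi=\varphi$, $\Psi:P\to P'$ a diffeomorphism over $\mathrm{id}_M$ with $\Psi(r\cdot p\cdot h)=\Phi(r)\cdot\Psi(p)\cdot h$, such that $\chi'\circ\Psi=\overline\Phi\circ\chi$, where $\overline\Phi(\eta)(g)=\Phi(\eta(g))$ for $\eta$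 in the band. An adapted $\mathbf G\to\mathbf H$-extension of $N[\mathcal U]$ is a $\mathbf G\to\mathbf H$-extension $(\mathcal R\stackrel{\varphi}{\to}N[\mathcal U],P,\chi)$ with: $\mathcal R=\mathbf G\times\coprod_{i,j}U_{ij}$ as a manifold and $\varphi$ the projection; $P=\coprod_iU_i\times\mathbf H$ with $(x_i,h)\cdot h'=(x_i,hh')$; $\chi(x_i,h)$ is $g\mapsto(h(g),x_{ii})$; and $(g,x_{ii})\bullet(g',x_{ij})=(gg',x_{ij})$. It is denoted $(\mathcal U,\bullet,\star)$ with $\bullet$ the product of $\mathcal R$ and $\star$ the action of $\mathcal R$ on $P$. A $\mathbf G\to\mathbf H$-valued non-Abelian $1$-cocycle w.r.t. $\mathcal U$ is a pair $(\lambda,\mathbf g)\in C^\infty(\coprod_{i,j}U_{ij},\mathbf H)\times C^\infty(\coprod_{i,j,k}U_{ijk},\mathbf G)$ with $\rho(\mathbf g_{ijk})\lambda_{ik}=\lambda_{ij}\lambda_{jk}$, $\mathbf g_{ijk}\mathbf g_{ikl}=\lambda_{ij}(\mathbf g_{jkl})\mathbf g_{ijl}$, $\mathbf g_{iik}=e$. The cocycle associated to $(\mathcal U,\bullet,\star)$ is defined by $(e,x_{ij})\star(x_j,e)=(x_i,\lambda_{ij})$ and $(e,x_{ij})\bullet(e,x_{jk})=(\mathbf g_{ijk},x_{ik})$. A $\mathbf G\to\mathbf H$-valued $1$-coboundary is a pair $(r,\mathbf v)\in C^\infty(\coprod_{i}U_{i},\mathbf H)\times C^\infty(\coprod_{i,j}U_{ij},\mathbf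 G)$; it relates $(\lambda,\mathbf g)$ and $(\lambda',\mathbf g')$ if for all indices $\lambda'_{ij}=\rho(\mathbf v_{ij})\,r_i\,\lambda_{ij}\,r_j^{-1}$ and $\mathbf g'_{ijk}\mathbf v_{ik}=\lambda'_{ij}(\mathbf v_{jk})\,\mathbf v_{ij}\,r_i(\mathbf g_{ijk})$. *)

(* Defs.v *)
(* MathComp and MathComp-Analysis *)
From HB Require Import structures.
From mathcomp Require Import all_boot all_order all_algebra.
From mathcomp Require Import all_classical all_reals.
From mathcomp Require Import topology normedtype landau derive.

Set Implicit Arguments.
Unset Strict Implicit.
Unset Printing Implicit Defensive.

Import Order.TTheory GRing.Theory Num.Theory.
Import numFieldNormedType.Exports.

Local Open Scope classical_set_scope.
Local Open Scope ring_scope.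

Section Smooth_maps.
Context {R : realType}.
Implicit Types V W X : normedModType R.

Fixpoint Ck V W (k : nat) (A : set V) (f : V -> W) : Prop :=
  if k is k'.+1 then
    (forall x, A x -> differentiable f x) /\
    (forall v, Ck k' A (fun x => 'D_v f x))
  else forall x, A x -> {for x, continuous f}.

Definition smooth_near V W (x : V) (f : V -> W) : Prop :=
  exists A : set V, [/\ open A, A x & forall k, Ck k A f].

Lemma near_eq_differentiable V W (f g : V -> W) x :
  (\forall y \near x, f y = g y) -> differentiable f x -> differentiable g x.
Proof.
move=> fg df.
have -> : g = f + (g - f) by rewrite addrC subrK.
apply: differentiableD => //.
have h0 : (g - f) \o shift x = cst ((g - f) x) + (0 : V -> W) +o_ 0 id.
  apply/eqaddoP => e e0.
  have fg0 : \forall y \near (0 : V), f (y + x) = g (y + x).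
    by move: fg; rewrite (near_shift 0 x) /=; apply: filterS => y /=; rewrite subr0.
  have fgx := nbhs_singleton fg.
  near=> y.
  rewrite /= !fctE fgx (near fg0 y) // !subrr addr0 subrr normr0.
  by rewrite mulr_ge0// ltW.
apply/diff_locallyP.
have -> : 'd (g - f) x = (0 : V -> W) :> (V -> W).
  pose z : {linear V -> W} := \0.
  by rewrite (@diff_unique _ _ _ (g - f) z x) // => ?; exact: cst_continuous.
by split => // ?; exact: cst_continuous.
Unshelve. all: by end_near. Qed.

Lemma open_near_eq V W (A : set V) (f g : V -> W) x : open A -> A x ->
  (forall x, A x -> f x = g x) -> \forall y \near x, f y = g y.
Proof.
by move=> oA Ax fg; apply: filterS (open_nbhs_nbhs (conj oA Ax)).
Qed.

Lemma Ck_eq V W k (A : set V) (f g : V -> W) : open A ->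
  (forall x, A x -> f x = g x) -> Ck k A f -> Ck k A g.
Proof.
move=> oA; elim: k f g => [|k IH] f g fg.
  move=> cf x Ax; rewrite /prop_for /continuous_at -(fg _ Ax).
  by apply: cvg_trans (cf x Ax); apply: near_eq_cvg; exact: open_near_eq fg.
move=> [df Df]; split.
  move=> x Ax; apply: near_eq_differentiable (df _ Ax).
  exact: open_near_eq fg.
move=> v; apply: IH (Df v) => x Ax.
by apply: near_eq_derive; exact: open_near_eq fg.
Qed.

Lemma Ck_sub V W k (A B : set V) (f : V -> W) : A `<=` B ->
  Ck k B f -> Ck k A f.
Proof.
move=> AB; elim: k f => [|k IH] f.
  by move=> cf x Ax; exact: cf (AB _ Ax).
by move=> [df Df]; split=> [x Ax|v]; [exact: df (AB _ Ax)|exact: IH (Df v)].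
Qed.

Lemma Ck_cst V W k (A : set V) (c : W) : Ck k A (cst c).
Proof.
elim: k c => [|k IH] c; first by move=> x _; exact: cst_continuous.
split=> [x _|v]; first exact: differentiable_cst.
have -> : (fun x => 'D_v (cst c) x) = cst (0 : W).
  by apply/funext => x; rewrite derive_cst.
exact: IH.
Qed.

Lemma Ck_linear V W k (A : set V) (f : {linear V -> W}) :
  continuous f -> Ck k A f.
Proof.
case: k => [|k] cf; first by move=> x _; exact: cf.
have df x : differentiable f x by exact: linear_differentiable.
split=> // v.
have -> : (fun x => 'D_v f x) = cst (f v).
  by apply/funext => x; rewrite deriveE// diff_lin.
exact: Ck_cst.
Qed.

Lemma Ck_add V W k (A : set V) (f g : V -> W) : open A ->
  Ck k A f -> Ck k A g -> Ck k A (f + g).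
Proof.
move=> oA; elim: k f g => [|k IH] f g.
  by move=> cf cg x Ax; apply: cvgD; [exact: cf|exact: cg].
move=> [df Df] [dg Dg]; split=> [x Ax|v].
  by apply: differentiableD; [exact: df|exact: dg].
apply: Ck_eq (IH _ _ (Df v) (Dg v)) => // x Ax.
by rewrite deriveD//; apply: diff_derivable; [exact: df|exact: dg].
Qed.

Lemma Ck_linear_comp V W X k (A : set V) (L : {linear W -> X}) (f : V -> W) :
  open A -> continuous L -> Ck k A f -> Ck k A (L \o f).
Proof.
move=> oA cL; have dL x : differentiable L x by exact: linear_differentiable.
elim: k f => [|k IH] f.
  by move=> cf x Ax; apply: continuous_comp; [exact: cf|exact: cL].
move=> [df Df]; split=> [x Ax|v].
  by apply: differentiable_comp => //; exact: df.
apply: Ck_eq (IH _ (Df v)) => // x Ax.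
have dfx := df _ Ax.
rewrite /comp [RHS]deriveE; last exact: differentiable_comp.
by rewrite diff_comp// diff_lin//= deriveE.
Qed.

Lemma Ck_comp_linear V W X k (A : set W) (L : {linear V -> W}) (f : W -> X) :
  continuous L -> Ck k A f -> Ck k (L @^-1` A) (f \o L).
Proof.
move=> cL; have dL x : differentiable L x by exact: linear_differentiable.
elim: k f => [|k IH] f.
  by move=> cf x Ax; apply: continuous_comp; [exact: cL|exact: cf].
move=> [df Df]; split=> [x Ax|v].
  by apply: differentiable_comp => //; exact: df.
have -> : (fun x => 'D_v (f \o L) x) = (fun x => 'D_(L v) f x) \o L.
  apply/funext => x /=; rewrite /derive /=.
  suff -> : (fun h : R => h^-1 *: (f (L (h *: v + x)) - f (L x))) =
      (fun h => h^-1 *: (f (h *: L v + L x) - f (L x))) by [].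
  apply/funext => h.
  by rewrite linearP.
exact: IH (Df _).
Qed.

End Smooth_maps.

Section Row_mx_smooth.
Context {R : realType} (m n p q : nat).

Let row_l (a : 'rV[R]_p) : 'rV[R]_(p + q) := row_mx a 0.
Let row_r (b : 'rV[R]_q) : 'rV[R]_(p + q) := row_mx 0 b.

Local Lemma row_l_linear : linear row_l.
Proof. by move=> k u v; rewrite /row_l scale_row_mx add_row_mx scaler0 addr0. Qed.

Local Lemma row_r_linear : linear row_r.
Proof. by move=> k u v; rewrite /row_r scale_row_mx add_row_mx scaler0 addr0. Qed.

Local Lemma row_l_continuous : continuous row_l.
Proof.
move=> u A /nbhs_ballP[e /= e0 eA]; apply/nbhs_ballP; exists e => //= v [_ uv].
by apply: eA; split => // i j; rewrite !mxE; case: splitP => k _; [exact: uv|rewrite mxE; exact: ballxx].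
Qed.

Local Lemma row_r_continuous : continuous row_r.
Proof.
move=> u A /nbhs_ballP[e /= e0 eA]; apply/nbhs_ballP; exists e => //= v [_ uv].
by apply: eA; split => // i j; rewrite !mxE; case: splitP => k _; [rewrite mxE; exact: ballxx|exact: uv].
Qed.

Lemma smooth_near_row_mx (F : 'rV[R]_m -> 'rV[R]_p) (G : 'rV[R]_n -> 'rV[R]_q)
    (v : 'rV[R]_(m + n)) :
  smooth_near (lsubmx v) F -> smooth_near (rsubmx v) G ->
  smooth_near v (fun w => row_mx (F (lsubmx w)) (G (rsubmx w))).
Proof.
move=> [A [oA Av sF]] [B [oB Bv sG]].
have oA' : open (lsubmx @^-1` A : set 'rV[R]_(m + n)).
  by apply: open_comp => // x _; exact: continuous_lsubmx.
have oB' : open (rsubmx @^-1` B : set 'rV[R]_(m + n)).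
  by apply: open_comp => // x _; exact: continuous_rsubmx.
pose L : {linear _ -> _} := HB.pack row_l (GRing.isLinear.Build _ _ _ _ _ row_l_linear).
pose S : {linear _ -> _} := HB.pack row_r (GRing.isLinear.Build _ _ _ _ _ row_r_linear).
have oAB := openI oA' oB'.
have cL : continuous L by exact: row_l_continuous.
have cS : continuous S by exact: row_r_continuous.
exists (lsubmx @^-1` A `&` rsubmx @^-1` B); split => // k.
have -> : (fun w => row_mx (F (lsubmx w)) (G (rsubmx w))) =
    (L \o (F \o lsubmx)) + (S \o (G \o rsubmx)).
  apply/funext => w; rewrite !fctE /= /row_l /row_r.
  by rewrite add_row_mx addr0 add0r.
apply: Ck_add => //; [apply: (Ck_linear_comp oAB cL)|apply: (Ck_linear_comp oAB cS)].

- have /Ck_sub : Ck k (lsubmx @^-1` A) (F \o (lsubmx : 'rV_(m + n) -> 'rV_m)).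
    by apply: Ck_comp_linear (sF k); exact: continuous_lsubmx.
  by apply=> w [].
- have /Ck_sub : Ck k (rsubmx @^-1` B) (G \o (rsubmx : 'rV_(m + n) -> 'rV_n)).
    by apply: Ck_comp_linear (sG k); exact: continuous_rsubmx.
  by apply=> w [].
Qed.

End Row_mx_smooth.

Section Manifolds.
Context (R : realType).

(* Charts are homeomorphisms from an open set [cdom] to an open part of R^n; the
   values of [cmap] outside [cdom] are irrelevant. *)
Record chart (T : topologicalType) (n : nat) := Chart {
  cdom : set T;
  cmap :> T -> 'rV[R]_n;
  cdom_open : open cdom;
  cmap_continuous : forall x, cdom x -> {for x, continuous cmap};
  cmap_inj : forall x y, cdom x -> cdom y -> cmap x = cmap y -> x = y;
  cmap_open : forall V, open V -> V `<=` cdom -> open (cmap @` V) }.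

(* A transition map [d \o c^-1] is expressed by a map [F] with [d = F \o c].
   The atlas need not be maximal.  No countability condition is imposed: the
   disjoint union of an uncountable open cover has to be a manifold. *)
Record manifold := Manifold {
  points :> topologicalType;
  mdim : nat;
  atlas : set (chart points mdim);
  points_hausdorff : hausdorff_space points;
  atlas_cover : forall x, exists2 c, atlas c & cdom c x;
  atlas_compat : forall c d x, atlas c -> atlas d -> cdom c x -> cdom d x ->
    exists2 F : 'rV[R]_mdim -> 'rV[R]_mdim,
      smooth_near (c x) F & \forall y \near x, d y = F (c y) }.

(* Smoothness on a subset [A] means that the expression of [f] in charts extends
   locally to a map of class C^infinity; for an embedded submanifold [A], this
   is smoothness for the submanifold structure.  Values outside [A] are
   irrelevant. *)
Definition smooth_on (M N : manifold) (A : set M) (f : M -> N) : Prop :=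
  forall x, A x -> f @ within A (nbhs x) --> f x /\
    forall (c : chart M (mdim M)) (d : chart N (mdim N)),
      atlas c -> atlas d -> cdom c x -> cdom d (f x) ->
      exists2 F : 'rV[R]_(mdim M) -> 'rV[R]_(mdim N),
        smooth_near (c x) F & \forall y \near x, A y -> d (f y) = F (c y).

Definition smooth (M N : manifold) (f : M -> N) : Prop := smooth_on setT f.

Definition submersion (M N : manifold) (f : M -> N) : Prop :=
  smooth f /\ forall x (c : chart M (mdim M)) (d : chart N (mdim N)),
    atlas c -> atlas d -> cdom c x -> cdom d (f x) ->
    exists F : 'rV[R]_(mdim M) -> 'rV[R]_(mdim N),
      [/\ smooth_near (c x) F,
          \forall y \near x, d (f y) = F (c y) &
          forall w, exists v, 'd F (c x) v = w].

Definition diffeomorphism (M N : manifold) (f : M -> N) : Prop :=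
  smooth f /\ exists g : N -> M, [/\ smooth g, cancel f g & cancel g f].

Lemma cmap_nbhs (T : topologicalType) n (c : chart T n) x (A : set T) :
  cdom c x -> nbhs x A -> nbhs (c x) (c @` A).
Proof.
move=> cx; rewrite nbhsE => -[B [oB Bx] BA].
have oBc : open (B `&` cdom c) by apply: openI => //; exact: cdom_open.
have oI : open (c @` (B `&` cdom c)) by apply: cmap_open => // ? [].
apply: filterS (open_nbhs_nbhs (conj oI _)); last by exists x.
by move=> _ [y [By _] <-]; exists y => //; exact: BA.
Qed.

End Manifolds.

Section Product_manifold.
Context {R : realType} (M N : manifold R).

Section Product_chart.
Context (c : chart R M (mdim M)) (d : chart R N (mdim N)).

Let pdom : set (M * N)%type := [set p | cdom c p.1 /\ cdom d p.2].
Let pmap (p : M * N) : 'rV[R]_(mdim M + mdim N) := row_mx (c p.1) (d p.2).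

Local Lemma pdom_open : open pdom.
Proof.
rewrite openE => -[x y] [/= cx dy]; exists (cdom c, cdom d) => //=.
by split; apply: open_nbhs_nbhs; split => //; exact: cdom_open.
Qed.

Local Lemma pmap_continuous p : pdom p -> {for p, continuous pmap}.
Proof.
case: p => x y [/= cx dy] U /nbhs_ballP[e /= e0 eU].
have U1 : nbhs x [set z | ball (c x) e (c z)].
  by apply: (@cmap_continuous _ _ _ c _ cx); exact: nbhsx_ballx.
have U2 : nbhs y [set z | ball (d y) e (d z)].
  by apply: (@cmap_continuous _ _ _ d _ dy); exact: nbhsx_ballx.
exists ([set z | ball (c x) e (c z)], [set z | ball (d y) e (d z)]) => //=.
move=> [z w] [/= [_ Bz] [_ Bw]]; apply: eU; split => // i j.
by rewrite !mxE; case: splitP => k _; [exact: Bz|exact: Bw].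
Qed.

Local Lemma pmap_inj p q : pdom p -> pdom q -> pmap p = pmap q -> p = q.
Proof.
case: p q => x y [z w] [/= cx dy] [/= cz dw] /eq_row_mx[cE dE].
by congr pair; [exact: cmap_inj cE|exact: cmap_inj dE].
Qed.

Local Lemma pmap_open V : open V -> V `<=` pdom -> open (pmap @` V).
Proof.
move=> oV Vd; rewrite openE => _ [[x y] Vxy <-].
have [/= cx dy] := Vd _ Vxy.
have [[A B] /= [nA nB] AB] : nbhs (x, y) V by exact: open_nbhs_nbhs.
have nA' := cmap_nbhs cx nA; have nB' := cmap_nbhs dy nB.
have l : nbhs (pmap (x, y)) [set v | (c @` A) (lsubmx v)].
  by apply: continuous_lsubmx; rewrite row_mxKl.
have r : nbhs (pmap (x, y)) [set v | (d @` B) (rsubmx v)].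
  by apply: continuous_rsubmx; rewrite row_mxKr.
apply: filterS (filterI l r) => v [[z Az zE] [w Bw wE]].
by exists (z, w); [exact: AB|rewrite /pmap /= zE wE hsubmxK].
Qed.

Definition prod_chart : chart R (M * N)%type (mdim M + mdim N) :=
  Chart pdom_open pmap_continuous pmap_inj pmap_open.

End Product_chart.

Let patlas : set (chart R (M * N)%type (mdim M + mdim N)) :=
  [set e | exists c d, [/\ atlas c, atlas d & e = prod_chart c d]].

Local Lemma phausdorff : hausdorff_space (M * N)%type.
Proof.
move=> [x y] [z w] cl; congr pair.
- apply: points_hausdorff => A B nA nB.
  have [|| [u v] [/= Au Bu]] := cl (fst @^-1` A) (fst @^-1` B).
  + exact: (cvg_fst nA).
  + exact: (cvg_fst nB).
  by exists u.
- apply: points_hausdorff => A B nA nB.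
  have [|| [u v] [/= Au Bu]] := cl (snd @^-1` A) (snd @^-1` B).
  + exact: (cvg_snd nA).
  + exact: (cvg_snd nB).
  by exists v.
Qed.

Local Lemma patlas_cover p : exists2 e, patlas e & cdom e p.
Proof.
case: p => x y; have [c Ac cx] := atlas_cover x.
have [d Ad dy] := atlas_cover y.
by exists (prod_chart c d) => //; exists c, d.
Qed.

Local Lemma patlas_compat e e' p : patlas e -> patlas e' -> cdom e p -> cdom e' p ->
  exists2 F : 'rV[R]_(mdim M + mdim N) -> 'rV[R]_(mdim M + mdim N),
    smooth_near (e p) F & \forall q \near p, e' q = F (e q).
Proof.
move=> [c [d [Ac Ad ->]]] [c' [d' [Ac' Ad' ->]]].
case: p => x y [/= cx dy] [/= c'x d'y].
have [F sF FE] := atlas_compat Ac Ac' cx c'x.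
have [G sG GE] := atlas_compat Ad Ad' dy d'y.
exists (fun v => row_mx (F (lsubmx v)) (G (rsubmx v))).
  by apply: smooth_near_row_mx => /=; rewrite ?row_mxKl ?row_mxKr.
exists ([set z | c' z = F (c z)], [set w | d' w = G (d w)]) => //.
by move=> [z w] [/= zE wE]; rewrite row_mxKl row_mxKr zE wE.
Qed.

Definition prod_manifold : manifold R :=
  Manifold phausdorff patlas_cover patlas_compat.

End Product_manifold.

(* The disjoint union of a family of open sets [W j] has as points the
   [existT _ j x] with [x] in the subtype [W j], written x_j in comments; its
   charts are those of [N] restricted to the copy of one [W j]. *)
Record open_family (R : realType) (N : manifold R) (J : choiceType) :=
  OpenFamily {
    member :> J -> set N;
    member_open : forall j, open (member j) }.

Section Disjoint_union.
Context (R : realType) (N : manifold R) (J : choiceType) (W : open_family N J).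

Let T : topologicalType := {j : J & W j}.

Definition du_index (p : T) : J := projT1 p.
Definition du_point (p : T) : N := val (projT2 p).
Definition du_mk (j : J) (x : N) (jx : W j x) : T :=
  existT (fun j => W j) j (exist _ x (mem_set jx)).

Lemma du_memP (p : T) : W (du_index p) (du_point p).
Proof. by case: p => j [x jx]; exact: set_mem. Qed.

Lemma du_ext (p q : T) :
  du_index p = du_index q -> du_point p = du_point q -> p = q.
Proof.
case: p q => i x [j y]; rewrite /du_index /du_point /= => ij.
by case: j / ij y => y xy; congr existT; exact: val_inj.
Qed.

Lemma du_nbhsP (p : T) (A : set T) : nbhs p A <->
  exists2 B, nbhs (du_point p) B &
    forall q, du_index q = du_index p -> B (du_point q) -> A q.
Proof.
case: p => j x; rewrite /du_index /du_point /=; split.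
  move=> [_ /= [[B oB <-] /= Bx] BA]; exists B; first exact: open_nbhs_nbhs.
  by move=> [i y] /= ij; case: j / ij x Bx BA => x Bx BA By; exact: BA.
rewrite nbhsE => -[B [C [oC Cx] CB] BA].
exists (val @^-1` C).
  split; first by exists C.
  exact: Cx.
by move=> y Cy; apply: BA => //; exact: CB.
Qed.

Lemma du_point_continuous : continuous du_point.
Proof. by move=> p A nA; apply/du_nbhsP; exists A. Qed.

Section Chart.
Context (j : J) (c : chart R N (mdim N)).

Let udom : set T := [set p | du_index p = j /\ cdom c (du_point p)].
Let umap (p : T) : 'rV[R]_(mdim N) := c (du_point p).

Local Lemma udom_open : open udom.
Proof.
rewrite openE => p [pj cp]; apply/du_nbhsP; exists (cdom c).
  by apply: open_nbhs_nbhs; split => //; exact: cdom_open.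
by move=> q qp cq; split => //; rewrite qp.
Qed.

Local Lemma umap_continuous p : udom p -> {for p, continuous umap}.
Proof.
move=> [_ cp]; apply: continuous_comp; first exact: du_point_continuous.
exact: cmap_continuous.
Qed.

Local Lemma umap_inj p q : udom p -> udom q -> umap p = umap q -> p = q.
Proof.
move=> [pj cp] [qj cq] pq; apply: du_ext; first by rewrite pj qj.
exact: cmap_inj pq.
Qed.

Local Lemma umap_open V : open V -> V `<=` udom -> open (umap @` V).
Proof.
move=> oV Vd; rewrite openE => _ [p Vp <-].
have [pj cp] := Vd _ Vp.
have /du_nbhsP[B nB BV] : nbhs p V by exact: open_nbhs_nbhs.
have nW : nbhs (du_point p) (W j).
  apply: open_nbhs_nbhs; split; first exact: member_open.
  by rewrite -pj; exact: du_memP.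
apply: filterS (cmap_nbhs cp (filterI nB nW)) => _ [x [Bx jx] <-].
by exists (du_mk jx) => //; apply: BV.
Qed.

Definition du_chart : chart R T (mdim N) :=
  Chart udom_open umap_continuous umap_inj umap_open.

End Chart.

Let uatlas : set (chart R T (mdim N)) :=
  [set e | exists j c, atlas c /\ e = du_chart j c].

Local Lemma uhausdorff : hausdorff_space T.
Proof.
apply: sigT_hausdorff => j x y cl; apply: val_inj.
apply: points_hausdorff => A B nA nB.
have [||z [/= Az Bz]] := cl (val @^-1` A) (val @^-1` B).
- exact: (@initial_continuous _ _ (val : W j -> N)).
- exact: (@initial_continuous _ _ (val : W j -> N)).
by exists (val z).
Qed.

Local Lemma uatlas_cover p : exists2 e, uatlas e & cdom e p.
Proof.
have [c Ac cp] := atlas_cover (du_point p).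
by exists (du_chart (du_index p) c) => //; exists (du_index p), c.
Qed.

Local Lemma uatlas_compat e e' p :
  uatlas e -> uatlas e' -> cdom e p -> cdom e' p ->
  exists2 F : 'rV[R]_(mdim N) -> 'rV[R]_(mdim N),
    smooth_near (e p) F & \forall q \near p, e' q = F (e q).
Proof.
move=> [j [c [Ac ->]]] [j' [c' [Ac' ->]]] [/= pj cp] [/= pj' c'p].
have [F sF FE] := atlas_compat Ac Ac' cp c'p.
by exists F => //; exact: (@du_point_continuous p _ FE).
Qed.

Definition disjoint_union : manifold R :=
  Manifold uhausdorff uatlas_cover uatlas_compat.

End Disjoint_union.

Section Disjoint_union_maps.
Context (R : realType) (N : manifold R).

Lemma smooth_near_differentiable (V W : normedModType R) (x : V) (F : V -> W) :
  smooth_near x F -> differentiable F x.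
Proof. by move=> [A [_ Ax /(_ 1)[dF _]]]; exact: dF. Qed.

Lemma transition_submersion (c d : chart R N (mdim N)) x :
  atlas c -> atlas d -> cdom c x -> cdom d x ->
  exists F : 'rV[R]_(mdim N) -> 'rV[R]_(mdim N),
    [/\ smooth_near (c x) F,
        \forall y \near x, d y = F (c y) &
        forall w, exists v, 'd F (c x) v = w].
Proof.
move=> Ac Ad cx dx.
have [F sF FE] := atlas_compat Ac Ad cx dx.
have [G sG GE] := atlas_compat Ad Ac dx cx.
exists F; split => // w; exists ('d G (d x) w).
have FGE : \forall z \near d x, (F \o G) z = id z.
  apply: filterS (cmap_nbhs dx (filterI FE GE)) => _ [y [yF yG] <-] /=.
  by rewrite -yG -yF.
have dG := smooth_near_differentiable sG.
have GdE : G (d x) = c x by rewrite (nbhs_singleton GE).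
have dF : differentiable F (G (d x)).
  by rewrite GdE; exact: smooth_near_differentiable.
have E : 'D_w (F \o G) (d x) = w.
  by rewrite (near_eq_derive w FGE) derive_id.
have dFG : differentiable (F \o G) (d x) by exact: differentiable_comp.
rewrite -{}GdE -[RHS]E (deriveE _ dFG).
exact: (esym (congr1 (fun h => h w) (diff_comp dG dF))).
Qed.

Context (J J' : choiceType) (W : open_family N J) (W' : open_family N J').

Lemma du_submersion (s : J -> J') (f : disjoint_union W -> disjoint_union W') :
  (forall p, du_index (f p) = s (du_index p)) ->
  (forall p, du_point (f p) = du_point p) -> submersion f.
Proof.
move=> fi fp.
have key p (c : chart R (disjoint_union W) (mdim N))
    (d : chart R (disjoint_union W') (mdim N)) :
    @atlas _ (disjoint_union W) c -> @atlas _ (disjoint_union W') d ->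
    cdom c p -> cdom d (f p) ->
    exists F : 'rV[R]_(mdim N) -> 'rV[R]_(mdim N),
      [/\ smooth_near (c p) F,
          \forall q \near p, d (f q) = F (c q) &
          forall w, exists v, 'd F (c p) v = w].
  move=> [j [c0 [Ac ->]]] [j' [d0 [Ad ->]]] [/= pj cp] [/= pj' dp].
  rewrite fp in dp.
  have [F [sF FE Fs]] := transition_submersion Ac Ad cp dp.
  exists F; split; [exact: sF| |exact: Fs].
  have FE' : nbhs p [set q | d0 (du_point q) = F (c0 (du_point q))].
    exact: (@du_point_continuous _ _ _ W p _ FE).
  apply: filterS FE' => q qE.
  exact: (etrans (congr1 d0 (fp q)) qE).
split=> [p _|p]; last exact: key.
split=> [A /du_nbhsP[B nB BA]|c d Ac Ad cp dp].
  apply/du_nbhsP; exists B; first by rewrite -fp.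
  by move=> q qp Bq _; apply: BA; rewrite ?fi ?qp// fp.
have [F [sF FE _]] := key _ _ _ Ac Ad cp dp.
by exists F => //; apply: filterS FE.
Qed.

End Disjoint_union_maps.

Record lie_group (R : realType) := LieGroup {
  lg_manifold :> manifold R;
  lmul : lg_manifold -> lg_manifold -> lg_manifold;
  lone : lg_manifold;
  linv : lg_manifold -> lg_manifold;
  lmulA : associative lmul;
  lmul1g : left_id lone lmul;
  lmulVg : left_inverse lone linv lmul;
  lmul_smooth : smooth (M := prod_manifold lg_manifold lg_manifold)
                  (fun p => lmul p.1 p.2);
  linv_smooth : smooth linv }.

Declare Scope lie_scope.
Notation "x ** y" := (lmul x y) (at level 40, left associativity) : lie_scope.
Local Open Scope lie_scope.

Arguments lone {R} _.

(* A morphism from [H] to Aut(G) is given by the smooth action of [H] on [G] by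
   automorphisms that it defines; [cm_act X h g] is the h(g) of the usual
   notation. *)
Record crossed_module (R : realType) (G H : lie_group R) := CrossedModule {
  cm_rho : G -> H;
  cm_act : H -> G -> G;
  cm_rho_smooth : smooth cm_rho;
  cm_rhoM : forall g g', cm_rho (g ** g') = cm_rho g ** cm_rho g';
  cm_act_smooth : smooth (M := prod_manifold H G) (fun p => cm_act p.1 p.2);
  cm_act_autM : forall h g g', cm_act h (g ** g') = cm_act h g ** cm_act h g';
  cm_act1 : forall g, cm_act (lone H) g = g;
  cm_actM : forall h h' g, cm_act (h ** h') g = cm_act h (cm_act h' g);
  cm_rho_act : forall h g, cm_rho (cm_act h g) = h ** cm_rho g ** linv h;
  cm_peiffer : forall g g', cm_act (cm_rho g) g' = g ** g' ** linv g }.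

(* Lie groupoids with manifold of arrows [A] and manifold of units [M].  The
   product [gmul x y] is meaningful, and subject to axioms, only when
   [tgt x = src y]. *)
Record lie_groupoid (R : realType) (A M : manifold R) := LieGroupoid {
  src : A -> M;
  tgt : A -> M;
  gmul : A -> A -> A;
  gunit : M -> A;
  ginv : A -> A;
  src_submersion : submersion src;
  tgt_submersion : submersion tgt;
  gunit_smooth : smooth gunit;
  ginv_smooth : smooth ginv;
  gmul_smooth : smooth_on (M := prod_manifold A A)
                  [set p | tgt p.1 = src p.2] (fun p => gmul p.1 p.2);
  src_gunit : forall m, src (gunit m) = m;
  tgt_gunit : forall m, tgt (gunit m) = m;
  src_gmul : forall x y, tgt x = src y -> src (gmul x y) = src x;
  tgt_gmul : forall x y, tgt x = src y -> tgt (gmul x y) = tgt y;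
  gmulA : forall x y z, tgt x = src y -> tgt y = src z ->
    gmul x (gmul y z) = gmul (gmul x y) z;
  gmul1x : forall x, gmul (gunit (src x)) x = x;
  gmulx1 : forall x, gmul x (gunit (tgt x)) = x;
  src_ginv : forall x, src (ginv x) = tgt x;
  tgt_ginv : forall x, tgt (ginv x) = src x;
  gmulxV : forall x, gmul x (ginv x) = gunit (src x);
  gmulVx : forall x, gmul (ginv x) x = gunit (tgt x) }.

Section Extensions.
Context (R : realType).
Implicit Types (G H : lie_group R) (A B M P : manifold R).

(* Morphisms of Lie groupoids over the identity of the base. *)
Definition groupoid_morphism A B M (K : lie_groupoid A M) (L : lie_groupoid B M)
    (f : A -> B) : Prop :=
  [/\ smooth f,
      forall x, src L (f x) = src K x,
      forall x, tgt L (f x) = tgt K x &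
      forall x y, tgt K x = src K y -> f (gmul K x y) = gmul L (f x) (f y)].

(* Right principal bundles, as locally trivial ones: over a neighbourhood [V]
   of each point, [triv] is an equivariant diffeomorphism from [V] times [H]
   to the part of [P] above [V], with inverse [p |-> (proj p, coord p)]. *)
Definition principal_bundle H P M (proj : P -> M) (ract : P -> H -> P) : Prop :=
  [/\ smooth proj,
      smooth (M := prod_manifold P H) (fun p => ract p.1 p.2),
      forall p h, proj (ract p h) = proj p,
      (forall p, ract p (lone H) = p) /\
      (forall p h h', ract (ract p h) h' = ract p (h ** h')) &
      forall m : M, exists V : set M, [/\ open V, V m &
        exists (triv : prod_manifold M H -> P) (coord : P -> H),
        [/\ smooth_on (M := prod_manifold M H) [set q | V q.1] triv,
            smooth_on [set p | V (proj p)] coord,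
            forall x h, V x ->
              [/\ proj (triv (x, h)) = x, coord (triv (x, h)) = h &
                  forall h', triv (x, h ** h') = ract (triv (x, h)) h'] &
            forall p, V (proj p) -> triv (proj p, coord p) = p]]].

(* Left actions; [lact x p] is meaningful only when [tgt x = proj p]. *)
Definition groupoid_action A M P (K : lie_groupoid A M) (proj : P -> M)
    (lact : A -> P -> P) : Prop :=
  [/\ smooth_on (M := prod_manifold A P)
        [set q | tgt K q.1 = proj q.2] (fun q => lact q.1 q.2),
      forall x p, tgt K x = proj p -> proj (lact x p) = src K x,
      forall p, lact (gunit K (proj p)) p = p &
      forall x y p, tgt K x = src K y -> tgt K y = proj p ->
        lact (gmul K x y) p = lact x (lact y p)].

Section Kernel.
Context (G : lie_group R) (A B M : manifold R).
Context (K : lie_groupoid A M) (L : lie_groupoid B M) (phi : A -> B).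

Definition groupoid_extension : Prop :=
  [/\ groupoid_morphism K L phi, submersion phi & forall y, exists x, phi x = y].

Definition kernel_fiber (m : M) : set A := [set x | phi x = gunit L m].

Definition kernel_over (V : set M) : set A :=
  [set x | exists2 m, V m & kernel_fiber m x].

(* Over a neighbourhood [V] of each point, [triv] is a diffeomorphism from
   [V] times [G] to the part of the kernel above [V], with inverse
   [x |-> (src x, coord x)], that is fibrewise a group isomorphism. *)
Definition locally_trivial_kernel : Prop :=
  forall m : M, exists V : set M, [/\ open V, V m &
    exists (triv : prod_manifold M G -> A) (coord : A -> G),
    [/\ smooth_on (M := prod_manifold M G) [set q | V q.1] triv,
        smooth_on (kernel_over V) coord,
        forall x g, V x ->
          [/\ kernel_fiber x (triv (x, g)), coord (triv (x, g)) = g &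
              forall g', triv (x, g ** g') = gmul K (triv (x, g)) (triv (x, g'))] &
        forall x y, V x -> kernel_fiber x y -> triv (x, coord y) = y]].

Definition G_extension : Prop := groupoid_extension /\ locally_trivial_kernel.

(* The fibre at [m] of the band: the isomorphisms of Lie groups from [G] to
   the fibre of the kernel at [m]. *)
Definition band (m : M) : set (G -> A) :=
  [set b | [/\ forall g, kernel_fiber m (b g),
               forall g g', b (g ** g') = gmul K (b g) (b g'),
               smooth b &
               exists b' : A -> G, [/\ smooth_on (kernel_fiber m) b', cancel b b' &
                 forall x, kernel_fiber m x -> b (b' x) = x]]].

End Kernel.

(* [ext_chi] is a map to the band, whose elements over m are maps from [G] to
   [A]; its smoothness is that of the map [(p, g) |-> ext_chi p g]. *)
Record GH_extension G H (X : crossed_module G H) B M (L : lie_groupoid B M)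
    A P := GHExtension {
  ext_groupoid : lie_groupoid A M;
  ext_phi : A -> B;
  ext_proj : P -> M;
  ext_ract : P -> H -> P;
  ext_lact : A -> P -> P;
  ext_chi : P -> G -> A;
  ext_phiP : G_extension G ext_groupoid L ext_phi;
  ext_bundleP : principal_bundle ext_proj ext_ract;
  ext_lactP : groupoid_action ext_groupoid ext_proj ext_lact;
  ext_lract : forall x p h, tgt ext_groupoid x = ext_proj p ->
    ext_lact x (ext_ract p h) = ext_ract (ext_lact x p) h;
  ext_chi_band : forall p, band ext_groupoid L ext_phi (ext_proj p) (ext_chi p);
  ext_chi_smooth : smooth (M := prod_manifold P G) (fun q => ext_chi q.1 q.2);
  ext_chi_equivariant : forall x p h g, tgt ext_groupoid x = ext_proj p ->
    ext_chi (ext_ract (ext_lact x p) h) g =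
    gmul ext_groupoid
      (gmul ext_groupoid x (ext_chi p (cm_act X h g))) (ginv ext_groupoid x);
  ext_rho : forall p g, ext_ract p (cm_rho X g) = ext_lact (ext_chi p g) p }.

(* As the projections to the base groupoid are over the identity and [Phi] is
   compatible with them, [Phi] is over the identity as well. *)
Definition GH_isomorphism G H (X : crossed_module G H) B M
    (L : lie_groupoid B M) A P A' P'
    (E : GH_extension X L A P) (E' : GH_extension X L A' P')
    (Phi : A -> A') (Psi : P -> P') : Prop :=
  [/\ [/\ groupoid_morphism (ext_groupoid E) (ext_groupoid E') Phi,
          diffeomorphism Phi &
          forall x, ext_phi E' (Phi x) = ext_phi E x],
      diffeomorphism Psi /\ (forall p, ext_proj E' (Psi p) = ext_proj E p),
      forall x p h, tgt (ext_groupoid E) x = ext_proj E p ->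
        Psi (ext_ract E (ext_lact E x p) h) =
        ext_ract E' (ext_lact E' (Phi x) (Psi p)) h &
      forall p g, ext_chi E' (Psi p) g = Phi (ext_chi E p g)].

End Extensions.

Record open_cover (R : realType) (N : manifold R) (I : choiceType) := OpenCover {
  cover_family :> open_family N I;
  coverP : forall x, exists i, cover_family i x }.

Section Cech_groupoid.
Context (R : realType) (N : manifold R) (I : choiceType) (U : open_cover N I).

Local Lemma double_open (ij : I * I) : open (U ij.1 `&` U ij.2).
Proof. by apply: openI; exact: member_open. Qed.

Local Lemma triple_open (ijk : I * I * I) :
  open (U ijk.1.1 `&` U ijk.1.2 `&` U ijk.2).
Proof. by do 2?apply: openI; exact: member_open. Qed.

Definition double_family : open_family N (I * I)%type := OpenFamily double_open.
Definition triple_family : open_family N (I * I * I)%type := OpenFamily triple_open.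

Definition U1 : manifold R := disjoint_union U.
Definition U2 : manifold R := disjoint_union double_family.
Definition U3 : manifold R := disjoint_union triple_family.

(* For [a : U2] the point x_ij, [cech_src a], [cech_tgt a] and [cech_inv a] are
   the points x_i, x_j and x_ji. *)
Definition cech_src (a : U2) : U1 := du_mk (proj1 (du_memP a)).
Definition cech_tgt (a : U2) : U1 := du_mk (proj2 (du_memP a)).

Definition cech_unit (x : U1) : U2 :=
  @du_mk _ _ _ double_family (du_index x, du_index x) (du_point x)
    (conj (du_memP x) (du_memP x)).

Definition cech_inv (a : U2) : U2 :=
  @du_mk _ _ _ double_family ((du_index a).2, (du_index a).1) (du_point a)
    (conj (proj2 (du_memP a)) (proj1 (du_memP a))).

(* The value [a] is a dummy, taken only when [a] and [b] are not
   composable. *)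
Definition cech_mul (a b : U2) : U2 :=
  if pselect (double_family ((du_index a).1, (du_index b).2) (du_point a)) is left ab
  then du_mk ab else a.

(* For [y : U3] the point x_ijk, [face01 y], [face12 y], [face02 y] and
   [vertex0 y] are the points x_ij, x_jk, x_ik and x_i. *)
Definition face01 (y : U3) : U2 :=
  @du_mk _ _ _ double_family (du_index y).1 (du_point y) (proj1 (du_memP y)).

Definition face12 (y : U3) : U2 :=
  @du_mk _ _ _ double_family ((du_index y).1.2, (du_index y).2) (du_point y)
    (conj (proj2 (proj1 (du_memP y))) (proj2 (du_memP y))).

Definition face02 (y : U3) : U2 :=
  @du_mk _ _ _ double_family ((du_index y).1.1, (du_index y).2) (du_point y)
    (conj (proj1 (proj1 (du_memP y))) (proj2 (du_memP y))).

Definition vertex0 (y : U3) : U1 := du_mk (proj1 (proj1 (du_memP y))).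

Local Lemma cech_src_submersion : submersion cech_src.
Proof. exact: (@du_submersion _ _ _ _ _ _ fst). Qed.

Local Lemma cech_tgt_submersion : submersion cech_tgt.
Proof. exact: (@du_submersion _ _ _ _ _ _ snd). Qed.

Local Lemma cech_unit_smooth : smooth cech_unit.
Proof. by have [] := @du_submersion _ _ _ _ _ _ (fun i => (i, i)) cech_unit. Qed.

Local Lemma cech_inv_smooth : smooth cech_inv.
Proof.
by have [] := @du_submersion _ _ _ _ _ _ (fun ij => (ij.2, ij.1)) cech_inv.
Qed.

Lemma cech_mulE (a b : U2) : cech_tgt a = cech_src b ->
  du_index (cech_mul a b) = ((du_index a).1, (du_index b).2) /\
  du_point (cech_mul a b) = du_point a.
Proof.
move=> ab; rewrite /cech_mul; case: pselect => // -[].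
have pab : du_point a = du_point b := congr1 (@du_point _ _ _ _) ab.
split; first by have [] := du_memP a.
by rewrite pab; have [] := du_memP b.
Qed.

Local Lemma cech_mul_smooth : smooth_on (M := prod_manifold U2 U2)
  [set p | cech_tgt p.1 = cech_src p.2] (fun p => cech_mul p.1 p.2).
Proof.
move=> [a b] /= ab; have [iab pab] := cech_mulE ab.
split=> [A nA|c d].
  have [B nB BA] := (du_nbhsP (W := double_family) (cech_mul a b) A).1 nA.
  have nBa : nbhs a [set a' | du_index a' = du_index a /\ B (du_point a')].
    by apply/du_nbhsP; exists B => //; rewrite -pab.
  have nb : nbhs b [set b' | du_index b' = du_index b].
    by apply/du_nbhsP; exists setT => //; exact: filterT.
  exists ([set a' : U2 | du_index a' = du_index a /\ B (du_point a')],
          [set b' : U2 | du_index b' = du_index b]) => //.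
  move=> [a' b'] [/= [ia Ba] ib] ab'; have [iab' pab'] := cech_mulE ab'.
  by apply: BA; rewrite ?pab'// iab' iab ia ib.
move=> [_ [_ [[j [c1 [Ac ->]]] [j' [c2 [Ac2 ->]]] ->]]].
move=> [k [d1 [Ad ->]]] [[/= aj c1a] [/= bj c2b]] [/= dk].
rewrite pab => d1a.
have [F [A [oA Aa sF]] FE] := atlas_compat Ac Ad c1a d1a.
pose n := mdim N.
exists (fun v : 'rV[R]_(n + n) => F (lsubmx v)).
  exists (lsubmx @^-1` A); split=> [||k'].
  - by apply: open_comp => // v _; exact: continuous_lsubmx.
  - by rewrite /= row_mxKl.
  - have : Ck k' (lsubmx @^-1` A) (F \o (lsubmx : 'rV_(n + n) -> 'rV_n)).
      by apply: Ck_comp_linear (sF k'); exact: continuous_lsubmx.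
    exact.
have nFE : nbhs a [set a' : U2 | d1 (du_point a') = F (c1 (du_point a'))].
  exact: (@du_point_continuous _ _ _ double_family a _ FE).
exists ([set a' : U2 | d1 (du_point a') = F (c1 (du_point a'))], setT).
  by split => //=; exact: filterT.
move=> [a' b'] [/= a'E _] ab'; have [_ pab'] := cech_mulE ab'.
by rewrite row_mxKl -a'E; exact: congr1 pab'.
Qed.

Local Lemma cech_src_mul a b : cech_tgt a = cech_src b ->
  cech_src (cech_mul a b) = cech_src a.
Proof. by case/cech_mulE => ab pab; apply: du_ext => //=; rewrite ab. Qed.

Local Lemma cech_tgt_mul a b : cech_tgt a = cech_src b ->
  cech_tgt (cech_mul a b) = cech_tgt b.
Proof.
move=> ab; have [iab pab] := cech_mulE ab; apply: du_ext.
  by rewrite /= [LHS](congr1 snd iab).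
rewrite [LHS]pab.
exact: (congr1 (@du_point _ _ _ _) ab).
Qed.

Local Lemma cech_mulP a b c : cech_tgt a = cech_src b ->
  du_index c = ((du_index a).1, (du_index b).2) -> du_point c = du_point a ->
  cech_mul a b = c.
Proof.
by move=> /cech_mulE[iab pab] ic pc; apply: du_ext; rewrite ?iab ?ic ?pab ?pc.
Qed.

Local Lemma cech_mulA a b c : cech_tgt a = cech_src b ->
  cech_tgt b = cech_src c ->
  cech_mul a (cech_mul b c) = cech_mul (cech_mul a b) c.
Proof.
move=> ab bc; have [iab pab] := cech_mulE ab; have [ibc pbc] := cech_mulE bc.
have a_bc : cech_tgt a = cech_src (cech_mul b c) by rewrite cech_src_mul.
have ab_c : cech_tgt (cech_mul a b) = cech_src c by rewrite cech_tgt_mul.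
have [i p] := cech_mulE ab_c.
by apply: cech_mulP => //; rewrite ?i ?p ?iab ?ibc ?pab.
Qed.

Local Lemma cech_mul1x a : cech_mul (cech_unit (cech_src a)) a = a.
Proof.
apply: cech_mulP => //; first exact: du_ext.
by rewrite [LHS]surjective_pairing.
Qed.

Local Lemma cech_mulx1 a : cech_mul a (cech_unit (cech_tgt a)) = a.
Proof.
apply: cech_mulP => //; first exact: du_ext.
by rewrite [LHS]surjective_pairing.
Qed.

Local Lemma cech_mulxV a : cech_mul a (cech_inv a) = cech_unit (cech_src a).
Proof. by apply: cech_mulP => //; exact: du_ext. Qed.

Local Lemma cech_mulVx a : cech_mul (cech_inv a) a = cech_unit (cech_tgt a).
Proof. by apply: cech_mulP => //; exact: du_ext. Qed.

Local Lemma cech_src_unit x : cech_src (cech_unit x) = x.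
Proof. exact: du_ext. Qed.

Local Lemma cech_tgt_unit x : cech_tgt (cech_unit x) = x.
Proof. exact: du_ext. Qed.

Local Lemma cech_src_inv a : cech_src (cech_inv a) = cech_tgt a.
Proof. exact: du_ext. Qed.

Local Lemma cech_tgt_inv a : cech_tgt (cech_inv a) = cech_src a.
Proof. exact: du_ext. Qed.

Definition cech_groupoid : lie_groupoid U2 U1 :=
  LieGroupoid cech_src_submersion cech_tgt_submersion cech_unit_smooth
    cech_inv_smooth cech_mul_smooth cech_src_unit cech_tgt_unit cech_src_mul
    cech_tgt_mul cech_mulA cech_mul1x cech_mulx1 cech_src_inv cech_tgt_inv
    cech_mulxV cech_mulVx.

End Cech_groupoid.

Section Adapted_extensions.
Context (R : realType) (N : manifold R) (I : choiceType) (U : open_cover N I).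
Context (G H : lie_group R) (X : crossed_module G H).

(* The product and the action denoted by bullet and star in (U, bullet, star)
   are the fields [gmul] of [ext_groupoid] and [ext_lact]. *)
Record adapted_extension := AdaptedExtension {
  ad_ext :> GH_extension X (cech_groupoid U)
              (prod_manifold G (U2 U)) (prod_manifold (U1 U) H);
  ad_phi : forall a, ext_phi ad_ext a = a.2;
  ad_proj : forall p, ext_proj ad_ext p = p.1;
  ad_ract : forall x h h', ext_ract ad_ext (x, h) h' = (x, h ** h');
  ad_chi : forall x h g, ext_chi ad_ext (x, h) g = (cm_act X h g, cech_unit x);
  ad_gmul : forall g g' a,
    gmul (ext_groupoid ad_ext) (g, cech_unit (cech_src a)) (g', a) =
    (g ** g', a) }.

Definition cochain1 : Type := (U2 U -> H) * (U3 U -> G).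
Definition cochain0 : Type := (U1 U -> H) * (U2 U -> G).

(* The components that are dropped here are x_i and x_ik, see
   [associated_lambdaE] and [associated_gE]. *)
Definition associated_cocycle (E : adapted_extension) : cochain1 :=
  (fun a => (ext_lact E (lone G, a) (cech_tgt a, lone H)).2,
   fun y => (gmul (ext_groupoid E) (lone G, face01 y) (lone G, face12 y)).1).

(* The 1-coboundaries relating [lg] to [lg']. *)
Definition coboundary (lg lg' : cochain1) : set cochain0 :=
  let: (lam, g) := lg in let: (lam', g') := lg' in
  [set rv | let: (r, v) := rv in
    [/\ smooth r, smooth v,
        forall a : U2 U, lam' a =
          cm_rho X (v a) ** r (cech_src a) ** lam a ** linv (r (cech_tgt a)) &
        forall y : U3 U, g' y ** v (face02 y) =
          cm_act X (lam' (face01 y)) (v (face12 y)) ** v (face01 y) **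
          cm_act X (r (vertex0 y)) (g y)]].

Definition iso_data : Type :=
  (prod_manifold G (U2 U) -> prod_manifold G (U2 U)) *
  (prod_manifold (U1 U) H -> prod_manifold (U1 U) H).

Definition isomorphisms (E E' : adapted_extension) : set iso_data :=
  [set F | GH_isomorphism E E' F.1 F.2].

Definition cochain_of_iso (F : iso_data) : cochain0 :=
  (fun x => (F.2 (x, lone H)).2, fun a => linv (F.1 (lone G, a)).1).

Definition iso_of_cochain (rv : cochain0) : iso_data :=
  (fun ga => (cm_act X (rv.1 (cech_src ga.2)) ga.1 ** linv (rv.2 ga.2), ga.2),
   fun xh => (xh.1, rv.1 xh.1 ** xh.2)).

Lemma associated_lambdaE (E : adapted_extension) (a : U2 U) :
  ext_lact E (lone G, a) (cech_tgt a, lone H) =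
  (cech_src a, (associated_cocycle E).1 a).
Proof.
rewrite [LHS]surjective_pairing; congr pair.
have [[[_ sE tE _] _ _] _] := ext_phiP E.
have [_ pE _ _] := ext_lactP E.
by rewrite -(ad_proj E) pE -?sE -?tE !(ad_phi E, ad_proj E).
Qed.

Lemma associated_gE (E : adapted_extension) (y : U3 U) :
  gmul (ext_groupoid E) (lone G, face01 y) (lone G, face12 y) =
  ((associated_cocycle E).2 y, face02 y).
Proof.
rewrite [LHS]surjective_pairing; congr pair.
have [[[_ sE tE mE] _ _] _] := ext_phiP E.
have yE : cech_tgt (face01 y) = cech_src (face12 y) by exact: du_ext.
rewrite -(ad_phi E) mE -?sE -?tE !(ad_phi E)//.
by have [i p] := cech_mulE yE; apply: du_ext; rewrite ?i ?p.
Qed.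

End Adapted_extensions.

(* Main.v *)
Require Import Defs.
From HB Require Import structures.
From mathcomp Require Import all_boot all_order all_algebra.
From mathcomp Require Import all_classical all_reals.
From mathcomp Require Import topology normedtype derive.

(** An adapted extension is determined by its cocycle.  Writing elements of the
    extension groupoid as (g, x_ij), every such element factors as
    (g, x_ii) . (e, x_ij), so the product and the action on the bundle are known
    once three things are known: the product of two elements (e, x_ij) and
    (e, x_jk), which is g_ijk by definition; the action of (e, x_ij) on
    (x_j, e), which is lambda_ij by definition; and the commutation of (e, x_ij)
    with an element (g, x_jj) of the kernel.  The last one comes from the
    equivariance of chi, which turns conjugation by (e, x_ij) into the
    automorphism lambda_ij.  This gives (lemmas [ad_gmulE] and [ad_lact])

      (g, x_ij) . (g', x_jk) = (g lambda_ij(g') g_ijk, x_ik),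
      (g, x_ij) * (x_j, h) = (x_i, rho(g) lambda_ij h).

    An isomorphism is determined in the same way by its values r_i on (x_i, e)
    and v_ij^-1 on (e, x_ij): equivariance under H gives its value on (x_i, h),
    and compatibility with chi gives its value (r_i(g), x_ii) on the kernel,
    hence its value on (g, x_ii) . (e, x_ij) (lemmas [iso_PsiE] and [iso_PhiE]).
    So every isomorphism is the one constructed from its own (r, v), and the two
    constructions are inverse to each other.

    With these formulas, that Phi respects products and that Psi is equivariant
    become the two coboundary equations when they are written on the elements
    (e, x_ij), (e, x_jk) and (x_j, e).  Conversely the coboundary equations give
    the general case through the identity
    lambda'_ij(r_j(g)) = v_ij r_i(lambda_ij(g)) v_ij^-1, a consequence of the
    first equation and of the Peiffer identity ([coboundary_intertwine]).
    Compatibility with chi moreover requires v_ii = e, which is the second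
    equation at the indices (i, i, i) ([coboundary_v1]).

    All the maps involved are composed from projections, r, v and the
    structure maps of the groups, so their smoothness reduces to the stability of
    smooth maps under composition and pairing.  In charts that is the chain rule
    at all orders ([Ck_comp]). *)

Set Implicit Arguments.
Unset Strict Implicit.
Unset Printing Implicit Defensive.

Import Order.TTheory GRing.Theory Num.Theory.
Import numFieldNormedType.Exports.

Local Open Scope classical_set_scope.
Local Open Scope ring_scope.
Local Open Scope lie_scope.

(** * Maps of class C^k: Leibniz and chain rules *)

Section Ck_chain.
Context {R : realType}.
Implicit Types V W : normedModType R.

Lemma Ck_pred V W k (A : set V) (f : V -> W) : Ck k.+1 A f -> Ck k A f.
Proof.
elim: k f => [|k IH] f [df Df].
  by move=> x Ax; exact: differentiable_continuous (df _ Ax).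
by split=> // v; apply: IH (Df v).
Qed.

Section Scale.
Context {V W : normedModType R}.

Let scale_bilinear_for : bilinear_for
    (GRing.Scale.Law.clone _ _ ( *:%R : R -> W -> W) _)
    (GRing.Scale.Law.clone _ _ ( *:%R : R -> W -> W) _)
    ( *:%R : R -> W -> W).
Proof.
split=> [w|a] b x y /=; first by rewrite scalerDl scalerA.
by rewrite scalerDr !scalerA mulrC.
Qed.

Let scale : {bilinear R -> W -> W} := HB.pack ( *:%R : R -> W -> W)
  (bilinear_isBilinear.Build R R W W _ _ _ scale_bilinear_for).

Let scale_cont : continuous (fun p : R * W => scale p.1 p.2).
Proof. by move=> p; exact: scale_continuous. Qed.

Lemma differentiable_scale (a : V -> R) (f : V -> W) x :
  differentiable a x -> differentiable f x ->
  differentiable (fun y => a y *: f y) x.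
Proof.
move=> da df.
apply: (@differentiable_comp _ _ _ _ (fun y => (a y, f y))
  (fun p => scale p.1 p.2)).
  exact: differentiable_pair.
exact: differentiable_bilin.
Qed.

Lemma derive_scale (a : V -> R) (f : V -> W) x v :
  differentiable a x -> differentiable f x ->
  'D_v (fun y => a y *: f y) x = a x *: 'D_v f x + 'D_v a x *: f x.
Proof.
move=> da df.
rewrite (deriveE _ (differentiable_scale da df)) (deriveE _ da) (deriveE _ df).
rewrite (diff_comp (f := fun y => (a y, f y)) (g := fun p => scale p.1 p.2)).
- by rewrite /= (diff_bilin _ scale_cont) diff_pair.
- exact: differentiable_pair.
- exact: differentiable_bilin.
Qed.

Lemma Ck_scale k (A : set V) (a : V -> R) (f : V -> W) : open A ->
  Ck k A a -> Ck k A f -> Ck k A (fun x => a x *: f x).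
Proof.
move=> oA; elim: k a f => [|k IH] a f Ca Cf.
  by move=> x Ax; apply: cvgZ; [exact: Ca|exact: Cf].
have [da Da] := Ca; have [df Df] := Cf; split=> [x Ax|v].
  by apply: differentiable_scale; [exact: da|exact: df].
apply: Ck_eq
  (Ck_add oA (IH _ _ (Ck_pred Ca) (Df v)) (IH _ _ (Da v) (Ck_pred Cf))) => //.
by move=> x Ax; rewrite derive_scale//; [exact: da|exact: df].
Qed.

End Scale.

Lemma Ck_sum V W k n (A : set V) (f : 'I_n -> V -> W) : open A ->
  (forall i, Ck k A (f i)) -> Ck k A (\sum_(i < n) f i).
Proof.
move=> oA Cf; elim/big_ind: _ => //; first exact: (@Ck_cst _ V W k A 0).
by move=> g h; exact: Ck_add.
Qed.

Lemma Ck_coord V n k (A : set V) (f : V -> 'rV[R]_n) (j : 'I_n) : open A ->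
  Ck k A f -> Ck k A (fun x => f x 0 j).
Proof.
move=> oA.
pose c (u : 'rV[R]_n) : R := u 0 j.
have lc : linear c by move=> a u v; rewrite /c !mxE.
pose L : {linear _ -> _} := HB.pack c (GRing.isLinear.Build _ _ _ _ _ lc).
by apply: (Ck_linear_comp (L := L)) => //; exact: coord_continuous.
Qed.

(** Finite dimension of the middle space makes the derivative of a composite a
    finite sum of products, each factor of which is one order less regular than
    [F] or [g]; this is what the induction in [Ck_comp] needs. *)
Lemma derive_comp V W n (F : V -> 'rV[R]_n) (g : 'rV[R]_n -> W) x v :
  differentiable F x -> differentiable g (F x) ->
  'D_v (g \o F) x = \sum_(j < n) 'D_v F x 0 j *: 'D_(delta_mx 0 j) g (F x).
Proof.
move=> dF dg; rewrite (deriveE _ (differentiable_comp dF dg)) diff_comp//=.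
rewrite (deriveE _ dF) {1}[X in 'd g _ X]row_sum_delta linear_sum.
by apply: eq_bigr => j _; rewrite linearZ deriveE.
Qed.

(** Induction on [k]: the directional derivative of the composite is a sum of
    products of coordinates of ['D_v F] with maps ['D_(delta_mx 0 j) g \o F],
    which are of class C^k by the induction hypothesis and the Leibniz rule
    [Ck_scale]. *)
Lemma Ck_comp V W n k (A : set V) (B : set 'rV[R]_n) (F : V -> 'rV[R]_n)
    (g : 'rV[R]_n -> W) : open A -> A `<=` F @^-1` B ->
  Ck k A F -> Ck k B g -> Ck k A (g \o F).
Proof.
move=> oA; elim: k g => [|k IH] g AB CF Cg.
  by move=> x Ax; apply: continuous_comp; [exact: CF|exact/Cg/AB].
have [dF DF] := CF; have [dg Dg] := Cg; split=> [x Ax|v].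
  by apply: differentiable_comp; [exact: dF|exact/dg/AB].
pose D j x : W := 'D_v F x 0 j *: ('D_(delta_mx 0 j) g \o F) x.
apply: (@Ck_eq _ _ _ _ _ (\sum_(j < n) D j)) => //.
  by move=> x Ax; rewrite fct_sumE derive_comp//; [exact: dF|exact/dg/AB].
apply: Ck_sum => // j; apply: Ck_scale => //.
  exact: Ck_coord (DF v).
exact: IH AB (Ck_pred CF) (Dg _).
Qed.

Lemma smooth_near_comp V W n x (F : V -> 'rV[R]_n) (g : 'rV[R]_n -> W) :
  smooth_near x F -> smooth_near (F x) g -> smooth_near x (g \o F).
Proof.
move=> [A [oA Ax CF]] [B [oB Bx Cg]].
have oAB : open (A `&` F @^-1` B).
  rewrite openE => y [Ay By]; apply: filterI; first exact: open_nbhs_nbhs.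
  exact: (CF 0 _ Ay) (open_nbhs_nbhs (conj oB By)).
exists (A `&` F @^-1` B); split=> // k.
apply: (Ck_comp (B := B)) (Cg k) => //.
by apply: Ck_sub (CF k) => y [].
Qed.

Lemma smooth_near_linear V W x (L : {linear V -> W}) :
  continuous L -> smooth_near x L.
Proof.
by move=> cL; exists setT; split=> //; [exact: openT|move=> k; exact: Ck_linear].
Qed.

End Ck_chain.

(** * Smooth maps between manifolds *)

Section Smooth_calculus.
Context {R : realType}.
Implicit Types M N P : manifold R.

(** The definition of smoothness on a subset, freed of its filter restrictions
    when the subset is the whole manifold. *)
Lemma smoothP M N (f : M -> N) : smooth f <->
  continuous f /\
  forall x (c : chart R M (mdim M)) (d : chart R N (mdim N)),
    atlas c -> atlas d -> cdom c x -> cdom d (f x) ->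
    exists2 F : 'rV[R]_(mdim M) -> 'rV[R]_(mdim N),
      smooth_near (c x) F & \forall y \near x, d (f y) = F (c y).
Proof.
split=> [sf|[cf lf] x _].
  split=> [x|x c d Ac Ad cx dx].
    by have [+ _] := sf x I; rewrite withinET.
  have [_ /(_ c d Ac Ad cx dx)[F sF FE]] := sf x I.
  by exists F => //; apply: filterS FE => y; exact.
split; first by rewrite withinET; exact: cf.
move=> c d Ac Ad cx dx; have [F sF FE] := lf x c d Ac Ad cx dx.
by exists F => //; apply: filterS FE => y + _.
Qed.

Lemma smooth_comp M N P (f : M -> N) (g : N -> P) :
  smooth f -> smooth g -> smooth (g \o f).
Proof.
move=> /smoothP[cf lf] /smoothP[cg lg]; apply/smoothP; split.
  by move=> x; apply: continuous_comp; [exact: cf|exact: cg].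
move=> x c e Ac Ae cx ex; have [d Ad dx] := atlas_cover (f x).
have [F sF FE] := lf x c d Ac Ad cx dx.
have [K sK KE] := lg (f x) d e Ad Ae dx ex.
exists (K \o F).
  by apply: smooth_near_comp => //; rewrite -(nbhs_singleton FE).
have KfE : \forall y \near x, e (g (f y)) = K (d (f y)) by exact: cf KE.
by apply: filterS2 FE KfE => y yF yK; rewrite /= yK yF.
Qed.

Lemma smooth_id M : smooth (@id M).
Proof.
apply/smoothP; split=> [x|x c d Ac Ad cx dx]; first exact: cvg_id.
exact: atlas_compat.
Qed.

Lemma smooth_cst M N (p : N) : smooth (fun _ : M => p).
Proof.
apply/smoothP; split=> [x|x c d Ac Ad cx dx]; first exact: cvg_cst.
exists (cst (d p)); last exact: filterE.
by exists setT; split=> //; [exact: openT|move=> k; exact: Ck_cst].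
Qed.

Lemma smooth_fst M N : smooth (M := prod_manifold M N) (fun p => p.1).
Proof.
apply/smoothP; split=> [x|x _ e [c [d [Ac Ad ->]]] Ae [/= cx dx] ex].
  exact: cvg_fst.
have [F sF FE] := atlas_compat Ac Ae cx ex.
exists (F \o lsubmx).
  apply: smooth_near_comp; last by rewrite /= row_mxKl.
  by apply: smooth_near_linear; exact: continuous_lsubmx.
have nFE : nbhs x [set y : M * N | e y.1 = F (c y.1)] by exact: cvg_fst FE.
by apply: filterS nFE => y yE; rewrite /= row_mxKl.
Qed.

Lemma smooth_snd M N : smooth (M := prod_manifold M N) (fun p => p.2).
Proof.
apply/smoothP; split=> [x|x _ e [c [d [Ac Ad ->]]] Ae [/= cx dx] ex].
  exact: cvg_snd.
have [F sF FE] := atlas_compat Ad Ae dx ex.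
exists (F \o rsubmx).
  apply: smooth_near_comp; last by rewrite /= row_mxKr.
  by apply: smooth_near_linear; exact: continuous_rsubmx.
have nFE : nbhs x [set y : M * N | e y.2 = F (d y.2)] by exact: cvg_snd FE.
by apply: filterS nFE => y yE; rewrite /= row_mxKr.
Qed.

(** Unlike in [smooth_near_row_mx] both maps depend on the same variable: compose
    with the diagonal. *)
Lemma smooth_near_diag m p q (F : 'rV[R]_m -> 'rV[R]_p)
    (K : 'rV[R]_m -> 'rV[R]_q) v :
  smooth_near v F -> smooth_near v K ->
  smooth_near v (fun w => row_mx (F w) (K w)).
Proof.
move=> sF sK.
pose diag (w : 'rV[R]_m) : 'rV[R]_(m + m) := row_mx w w.
have ldiag : linear diag by move=> a u w; rewrite /diag scale_row_mx add_row_mx.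
pose L : {linear _ -> _} := HB.pack diag (GRing.isLinear.Build _ _ _ _ _ ldiag).
have cL : continuous L.
  move=> u A /nbhs_ballP[e /= e0 eA]; apply/nbhs_ballP; exists e => //= w [_ uw].
  by apply: eA; split=> // i j; rewrite !mxE; case: splitP => k _; exact: uw.
have -> : (fun w => row_mx (F w) (K w)) =
    (fun w => row_mx (F (lsubmx w)) (K (rsubmx w))) \o L.
  by apply/funext => w; rewrite /= /diag row_mxKl row_mxKr.
apply: smooth_near_comp; first exact: smooth_near_linear.
by apply: smooth_near_row_mx; rewrite /= ?row_mxKl ?row_mxKr.
Qed.

Lemma smooth_pair M N P (f : M -> N) (g : M -> P) : smooth f -> smooth g ->
  smooth (N := prod_manifold N P) (fun x => (f x, g x)).
Proof.
move=> /smoothP[cf lf] /smoothP[cg lg]; apply/smoothP; split.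
  by move=> x; apply: cvg_pair; [exact: cf|exact: cg].
move=> x c _ Ac [d [e [Ad Ae ->]]] cx [/= dx ex].
have [F sF FE] := lf x c d Ac Ad cx dx.
have [K sK KE] := lg x c e Ac Ae cx ex.
exists (fun w => row_mx (F w) (K w)); first exact: smooth_near_diag.
by apply: filterS2 FE KE => y /= -> ->.
Qed.

End Smooth_calculus.

(** * Lie groups, crossed modules and Lie groupoids *)

Section Lie_group_theory.
Context {R : realType} {G : lie_group R}.
Implicit Types x y z : G.

Lemma lmulKg x y : linv x ** (x ** y) = y.
Proof. by rewrite lmulA lmulVg lmul1g. Qed.

Lemma lmulgI x y z : x ** y = x ** z -> y = z.
Proof. by move=> /(congr1 (lmul (linv x))); rewrite !lmulKg. Qed.

Lemma lmulg1 x : x ** lone G = x.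
Proof. by apply: (@lmulgI (linv x)); rewrite lmulKg lmulVg. Qed.

Lemma lmulgV x : x ** linv x = lone G.
Proof. by apply: (@lmulgI (linv x)); rewrite lmulKg lmulg1. Qed.

Lemma lmulKVg x y : x ** (linv x ** y) = y.
Proof. by rewrite lmulA lmulgV lmul1g. Qed.

Lemma linvK x : linv (linv x) = x.
Proof. by apply: (@lmulgI (linv x)); rewrite lmulgV lmulVg. Qed.

Lemma linv1 : linv (lone G) = lone G.
Proof. by apply: (@lmulgI (lone G)); rewrite lmulgV lmul1g. Qed.

Lemma lmul_idem x : x ** x = x -> x = lone G.
Proof. by rewrite -[in RHS](lmulg1 x) => /lmulgI. Qed.

End Lie_group_theory.

Section Crossed_module_theory.
Context {R : realType} {G H : lie_group R} (X : crossed_module G H).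

Lemma cm_actg1 h : cm_act X h (lone G) = lone G.
Proof. by apply: lmul_idem; rewrite -cm_act_autM lmul1g. Qed.

Lemma cm_actV h g : cm_act X h (linv g) = linv (cm_act X h g).
Proof.
by apply: (@lmulgI _ _ (cm_act X h g)); rewrite -cm_act_autM !lmulgV cm_actg1.
Qed.

Lemma cm_actKV h g : cm_act X h (cm_act X (linv h) g) = g.
Proof. by rewrite -cm_actM lmulgV cm_act1. Qed.

Lemma cm_actK h g : cm_act X (linv h) (cm_act X h g) = g.
Proof. by rewrite -cm_actM lmulVg cm_act1. Qed.

Lemma cm_rho1 : cm_rho X (lone G) = lone H.
Proof. by apply: lmul_idem; rewrite -cm_rhoM lmul1g. Qed.

Lemma cm_rhoV g : cm_rho X (linv g) = linv (cm_rho X g).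
Proof.
by apply: (@lmulgI _ _ (cm_rho X g)); rewrite -cm_rhoM !lmulgV cm_rho1.
Qed.

End Crossed_module_theory.

Section Groupoid_theory.
Context {R : realType}.
Implicit Types A B M : manifold R.

(** Units are the only idempotents, so that morphisms preserve them. *)
Lemma gmul_idem A M (K : lie_groupoid A M) x : tgt K x = src K x ->
  gmul K x x = x -> x = gunit K (src K x).
Proof.
move=> tx xx; rewrite -(gmulxV K x) -[X in gmul K X _]xx.
by rewrite -gmulA ?src_ginv// gmulxV -tx gmulx1.
Qed.

Lemma groupoid_morphism_unit A B M (K : lie_groupoid A M) (L : lie_groupoid B M)
    (f : A -> B) m : groupoid_morphism K L f -> f (gunit K m) = gunit L m.
Proof.
move=> [_ fs ft fM]; have E : src L (f (gunit K m)) = m by rewrite fs src_gunit.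
rewrite [LHS](@gmul_idem _ _ L) ?E//; first by rewrite ft tgt_gunit.
rewrite -fM ?src_gunit ?tgt_gunit//.
by have := gmul1x K (gunit K m); rewrite src_gunit => ->.
Qed.

Lemma gmulKV A M (K : lie_groupoid A M) x y : tgt K x = tgt K y ->
  gmul K (gmul K x (ginv K y)) y = x.
Proof.
by move=> xy; rewrite -gmulA ?src_ginv ?tgt_ginv// gmulVx -xy gmulx1.
Qed.

End Groupoid_theory.

(** * Structure of adapted extensions *)

Section Cech_theory.
Context {R : realType} {N : manifold R} {I : choiceType} {U : open_cover N I}.

Lemma cech_src_cech_unit (x : U1 U) : cech_src (cech_unit x) = x.
Proof. exact: (src_gunit (cech_groupoid U)). Qed.

Lemma cech_tgt_cech_unit (x : U1 U) : cech_tgt (cech_unit x) = x.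
Proof. exact: (tgt_gunit (cech_groupoid U)). Qed.

(** Extends the product formula [ad_gmulE], which is indexed by triple
    intersections, to arbitrary composable arrows. *)
Lemma composableP (a b : U2 U) : cech_tgt a = cech_src b ->
  exists y : U3 U, a = face01 y /\ b = face12 y.
Proof.
move=> ab; have iab := congr1 (@du_index _ _ _ _) ab.
have pab : du_point a = du_point b := congr1 (@du_point _ _ _ _) ab.
have yP : triple_family U ((du_index a).1, (du_index a).2, (du_index b).2)
    (du_point a).
  split; first exact: (du_memP a).
  by rewrite pab; have [] := du_memP b.
exists (du_mk yP); split; apply: du_ext => //.
  by rewrite [LHS]surjective_pairing.
by rewrite [LHS]surjective_pairing; congr pair; exact: esym iab.
Qed.

Lemma composable_faces (y : U3 U) : cech_tgt (face01 y) = cech_src (face12 y).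
Proof. exact: du_ext. Qed.

End Cech_theory.

Section Adapted_theory.
Context {R : realType} {N : manifold R} {I : choiceType} {U : open_cover N I}.
Context {G H : lie_group R} {X : crossed_module G H}.
Context (E : adapted_extension U X).
Notation K := (ext_groupoid E).
Notation lam := (associated_cocycle E).1.
Notation gam := (associated_cocycle E).2.

Lemma ad_src a : src K a = cech_src a.2.
Proof. by have [[[_ sE _ _] _ _] _] := ext_phiP E; rewrite -sE ad_phi. Qed.

Lemma ad_tgt a : tgt K a = cech_tgt a.2.
Proof. by have [[[_ _ tE _] _ _] _] := ext_phiP E; rewrite -tE ad_phi. Qed.

(** The relation p . rho(g) = chi(p)(g) . p at p = (x_i, h), applied to
    h^-1(g) because chi(x_i, h) involves h(g). *)
Lemma ad_kernel_lact g x h :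
  ext_lact E (g, cech_unit x) (x, h) = (x, cm_rho X g ** h).
Proof.
have := ext_rho E (x, h) (cm_act X (linv h) g).
rewrite ad_ract ad_chi cm_actKV cm_rho_act linvK -!lmulA lmulKVg.
exact: esym.
Qed.

Lemma ad_factor g a :
  (g, a) = gmul K (g, cech_unit (cech_src a)) (lone G, a).
Proof. by rewrite ad_gmul lmulg1. Qed.

(** By right equivariance, (x_j, h) = (x_j, e) . h reduces the action of (e, x_ij)
    to the definition of lambda_ij. *)
Lemma ad_lact g a h : ext_lact E (g, a) (cech_tgt a, h) =
  (cech_src a, cm_rho X g ** lam a ** h).
Proof.
have [_ _ _ lactM] := ext_lactP E.
have lact1 : ext_lact E (lone G, a) (cech_tgt a, h) = (cech_src a, lam a ** h).
  rewrite -[h in LHS]lmul1g -(ad_ract E) ext_lract ?ad_tgt ?ad_proj//.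
  by rewrite associated_lambdaE ad_ract.
rewrite (ad_factor g a) lactM ?ad_tgt ?ad_src ?ad_proj//= ?cech_tgt_cech_unit//.
by rewrite lact1 ad_kernel_lact lmulA.
Qed.

(** Equivariance of chi at p = (x_j, e): conjugation of (g, x_jj) by (e, x_ij) is
    chi(x_i, lambda_ij)(g) = (lambda_ij(g), x_ii). *)
Lemma ad_gmul_kernel g a :
  gmul K (lone G, a) (g, cech_unit (cech_tgt a)) = (cm_act X (lam a) g, a).
Proof.
have tp : tgt K (lone G, a) = ext_proj E (cech_tgt a, lone H).
  by rewrite ad_tgt ad_proj.
have := ext_chi_equivariant (lone H) g tp.
rewrite associated_lambdaE ad_ract !ad_chi !cm_act1 lmulg1.
move=> /(congr1 (fun x => gmul K x (lone G, a))).
rewrite ad_gmul lmulg1 gmulKV; first exact: esym.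
by rewrite tgt_gmul ad_tgt ?ad_tgt ?ad_src/=
  ?(cech_src_cech_unit, cech_tgt_cech_unit).
Qed.

(** Move (g', x_jj) to the left through (e, x_ij). *)
Lemma ad_gmulE g g' y : gmul K (g, face01 y) (g', face12 y) =
  (g ** cm_act X (lam (face01 y)) g' ** gam y, face02 y).
Proof.
have t01 := composable_faces y.
have s02 : cech_src (face01 y) = cech_src (face02 y) by exact: du_ext.
have gk : gmul K (g, face01 y) (g', cech_unit (cech_tgt (face01 y))) =
    (g ** cm_act X (lam (face01 y)) g', face01 y).
  rewrite (ad_factor g) -gmulA ?ad_tgt ?ad_src/=
    ?(cech_src_cech_unit, cech_tgt_cech_unit)//.
  by rewrite ad_gmul_kernel ad_gmul.
rewrite (ad_factor g') -t01 gmulA ?ad_tgt ?ad_src/=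
  ?(cech_src_cech_unit, cech_tgt_cech_unit)//.
rewrite gk (ad_factor _ (face01 y)) -gmulA ?ad_tgt ?ad_src/=
  ?(cech_src_cech_unit, cech_tgt_cech_unit)//.
by rewrite associated_gE s02 ad_gmul.
Qed.

Lemma associated_lambda1 x : (associated_cocycle E).1 (cech_unit x) = lone H.
Proof.
have := associated_lambdaE E (cech_unit x).
rewrite cech_tgt_cech_unit ad_kernel_lact lmulg1 cm_rho1 => lE.
exact: esym (congr1 snd lE).
Qed.

(** The axiom (g, x_ii) . (g', x_ij) = (g g', x_ij) of adapted extensions makes
    (e, x_ii) a left unit. *)
Lemma associated_g1 (y : U3 U) : (du_index y).1.1 = (du_index y).1.2 ->
  (associated_cocycle E).2 y = lone G.
Proof.
move=> iy; have := associated_gE E y.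
have -> : face01 y = cech_unit (cech_src (face12 y)).
  by apply: du_ext => //=; rewrite [LHS]surjective_pairing [LHS]/= iy.
rewrite ad_gmul lmul1g => gE; exact: esym (congr1 fst gE).
Qed.

End Adapted_theory.

(** * Smoothness of maps to a group *)

Section Smooth_group_maps.
Context {R : realType} {G H : lie_group R} (X : crossed_module G H).
Context {M : manifold R}.

Lemma smooth_lmul (f g : M -> G) : smooth f -> smooth g ->
  smooth (fun x => f x ** g x).
Proof.
by move=> sf sg; exact: (smooth_comp (smooth_pair sf sg) (@lmul_smooth _ G)).
Qed.

Lemma smooth_linv (f : M -> G) : smooth f -> smooth (fun x => linv (f x)).
Proof. by move=> sf; exact: smooth_comp sf (@linv_smooth _ G). Qed.

Lemma smooth_cm_act (f : M -> H) (g : M -> G) : smooth f -> smooth g ->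
  smooth (fun x => cm_act X (f x) (g x)).
Proof.
by move=> sf sg; exact: (smooth_comp (smooth_pair sf sg) (cm_act_smooth X)).
Qed.

End Smooth_group_maps.

Lemma smooth_cech_src (R : realType) (N : manifold R) (I : choiceType)
  (U : open_cover N I) : smooth (@cech_src R N I U).
Proof. by have [] := src_submersion (cech_groupoid U). Qed.

(** * From isomorphisms to coboundaries *)

Section Isomorphism_to_coboundary.
Context {R : realType} {N : manifold R} {I : choiceType} {U : open_cover N I}.
Context {G H : lie_group R} {X : crossed_module G H}.
Context (E E' : adapted_extension U X) (F : iso_data U G H).
Context (FP : isomorphisms E E' F).
Notation r := (cochain_of_iso F).1.
Notation v := (cochain_of_iso F).2.

Lemma iso_Psi1 x : F.2 (x, lone H) = (x, r x).
Proof.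
have [_ [_ projF] _ _] := FP.
rewrite [LHS]surjective_pairing; congr pair.
by have := projF (x, lone H); rewrite !ad_proj.
Qed.

Lemma iso_Phi1 a : F.1 (lone G, a) = (linv (v a), a).
Proof.
have [[_ _ phiF] _ _ _] := FP.
rewrite [LHS]surjective_pairing /= linvK; congr pair.
by have := phiF (lone G, a); rewrite !ad_phi.
Qed.

(** Equivariance along the unit arrow at x_i, which Phi preserves, leaves the
    H-equivariance of Psi. *)
Lemma iso_PsiE x h : F.2 (x, h) = (x, r x ** h).
Proof.
have [[morF _ _] _ eqF _] := FP.
have [_ _ act1 _] := ext_lactP E; have [_ _ act1' _] := ext_lactP E'.
have := eqF (gunit (ext_groupoid E) x) (x, lone H) h.
rewrite tgt_gunit ad_proj => /(_ erefl).
rewrite (groupoid_morphism_unit x morF) iso_Psi1.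
have := act1 (x, lone H); rewrite ad_proj => ->.
have := act1' (x, r x); rewrite ad_proj => ->.
by rewrite !ad_ract lmul1g.
Qed.

(** On the kernel Phi is prescribed by chi' o Psi = Phi o chi at (x_i, e); the
    factorization (g, x_ij) = (g, x_ii) . (e, x_ij) gives the rest. *)
Lemma iso_PhiE g a : F.1 (g, a) = (cm_act X (r (cech_src a)) g ** linv (v a), a).
Proof.
have [[[_ _ _ morF] _ _] _ _ chiF] := FP.
have kerF : F.1 (g, cech_unit (cech_src a)) =
    (cm_act X (r (cech_src a)) g, cech_unit (cech_src a)).
  have := chiF (cech_src a, lone H) g.
  by rewrite iso_Psi1 !ad_chi cm_act1 => /esym.
rewrite (ad_factor E) morF; last first.
  by rewrite ad_tgt ad_src /= cech_tgt_cech_unit.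
by rewrite kerF iso_Phi1 ad_gmul.
Qed.

Lemma smooth_r_of_iso : smooth r.
Proof.
have [_ [[sF _] _] _ _] := FP.
have si : smooth (N := prod_manifold (U1 U) H) (fun x : U1 U => (x, lone H)).
  by apply: smooth_pair; [exact: smooth_id|exact: smooth_cst].
exact: smooth_comp (smooth_comp si sF) (@smooth_snd _ _ _).
Qed.

Lemma smooth_v_of_iso : smooth v.
Proof.
have [[_ [sF _] _] _ _ _] := FP.
have si : smooth (N := prod_manifold G (U2 U)) (fun a : U2 U => (lone G, a)).
  by apply: smooth_pair; [exact: smooth_cst|exact: smooth_id].
exact: smooth_linv (smooth_comp (smooth_comp si sF) (@smooth_fst _ _ _)).
Qed.

(** Equivariance of Psi for the arrow (e, x_ij) and the point (x_j, e). *)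
Lemma iso_coboundary_lambda a : (associated_cocycle E').1 a =
  cm_rho X (v a) ** r (cech_src a) ** (associated_cocycle E).1 a **
  linv (r (cech_tgt a)).
Proof.
have [_ _ eqF _] := FP.
have := eqF (lone G, a) (cech_tgt a, lone H) (lone H).
rewrite ad_tgt ad_proj => /(_ erefl).
rewrite associated_lambdaE iso_Phi1 iso_Psi1 ad_lact !ad_ract !lmulg1 iso_PsiE.
move=> -[E1]; rewrite -!lmulA [r _ ** (_ ** _)]lmulA E1 cm_rhoV.
by rewrite -!lmulA lmulgV lmulg1 lmulKVg.
Qed.

(** Multiplicativity of Phi on (e, x_ij) and (e, x_jk). *)
Lemma iso_coboundary_g y : (associated_cocycle E').2 y ** v (face02 y) =
  cm_act X ((associated_cocycle E').1 (face01 y)) (v (face12 y)) **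
  v (face01 y) ** cm_act X (r (vertex0 y)) ((associated_cocycle E).2 y).
Proof.
have [[[_ _ _ morF] _ _] _ _ _] := FP.
have := morF (lone G, face01 y) (lone G, face12 y).
rewrite ad_tgt ad_src => /(_ (composable_faces y)).
rewrite associated_gE !iso_Phi1 iso_PhiE ad_gmulE cm_actV => -[E1].
have -> : vertex0 y = cech_src (face02 y) by exact: du_ext.
set x := cm_act X _ ((associated_cocycle E).2 y) in E1 *.
have -> : x = linv (v (face01 y)) **
    linv (cm_act X ((associated_cocycle E').1 (face01 y)) (v (face12 y))) **
    (associated_cocycle E').2 y ** v (face02 y).
  by rewrite -E1 -!lmulA lmulVg lmulg1.
by rewrite -!lmulA !lmulKVg.
Qed.

Lemma cochain_of_isoK : iso_of_cochain X (cochain_of_iso F) = F.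
Proof.
rewrite [RHS]surjective_pairing; congr pair; apply/funext => -[x y] /=.
  exact: esym (iso_PhiE x y).
exact: esym (iso_PsiE x y).
Qed.

End Isomorphism_to_coboundary.

(** * From coboundaries to isomorphisms *)

Section Coboundary_to_isomorphism.
Context {R : realType} {N : manifold R} {I : choiceType} {U : open_cover N I}.
Context {G H : lie_group R} {X : crossed_module G H}.

Lemma diffeomorphism_Phi_of_cochain (r : U1 U -> H) (v : U2 U -> G) :
  smooth r -> smooth v -> diffeomorphism (iso_of_cochain X (r, v)).1.
Proof.
move=> sr sv.
have sg := @smooth_fst _ G (U2 U); have sa := @smooth_snd _ G (U2 U).
have srs := smooth_comp (smooth_comp sa (@smooth_cech_src _ _ _ U)) sr.
have sva := smooth_comp sa sv.
split.
  apply: smooth_pair sa.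
  by apply: smooth_lmul; [exact: smooth_cm_act|exact: smooth_linv].
exists (fun ga => (cm_act X (linv (r (cech_src ga.2))) (ga.1 ** v ga.2), ga.2)).
split=> [||[g a] /=].
- apply: smooth_pair sa.
  by apply: smooth_cm_act; [exact: smooth_linv|exact: smooth_lmul].
- by move=> [g a] /=; rewrite -lmulA lmulVg lmulg1 cm_actK.
- by rewrite cm_actKV -lmulA lmulgV lmulg1.
Qed.

Lemma diffeomorphism_Psi_of_cochain (r : U1 U -> H) (v : U2 U -> G) :
  smooth r -> diffeomorphism (iso_of_cochain X (r, v)).2.
Proof.
move=> sr.
have sx := @smooth_fst _ (U1 U) H; have sh := @smooth_snd _ (U1 U) H.
have srx := smooth_comp sx sr.
split; first by apply: smooth_pair sx _; exact: smooth_lmul.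
exists (fun xh => (xh.1, linv (r xh.1) ** xh.2)); split=> [||[x h] /=].
- by apply: smooth_pair sx _; apply: smooth_lmul => //; exact: smooth_linv.
- by move=> [x h] /=; rewrite lmulKg.
- by rewrite lmulKVg.
Qed.

Context (E E' : adapted_extension U X).

Context (r : U1 U -> H) (v : U2 U -> G).
Context (rvP :
  coboundary X (associated_cocycle E) (associated_cocycle E') (r, v)).
Notation lam := (associated_cocycle E).1.
Notation lam' := (associated_cocycle E').1.
Notation gam := (associated_cocycle E).2.
Notation gam' := (associated_cocycle E').2.

Lemma coboundaryP : [/\ smooth r, smooth v,
  forall a, lam' a = cm_rho X (v a) ** r (cech_src a) ** lam a **
    linv (r (cech_tgt a)) &
  forall y, gam' y ** v (face02 y) =
    cm_act X (lam' (face01 y)) (v (face12 y)) ** v (face01 y) **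
    cm_act X (r (vertex0 y)) (gam y)].
Proof.
by move: rvP; case: (associated_cocycle E) => ? ?; case: (associated_cocycle E').
Qed.

(** The second coboundary equation at the indices (i, i, i), where
    lambda'_ii = e and g_iii = g'_iii = e, reads v_ii = v_ii v_ii. *)
Lemma coboundary_v1 x : v (cech_unit x) = lone G.
Proof.
have [_ _ _ gE] := coboundaryP.
pose y : U3 U := @du_mk _ _ _ (triple_family U)
  (du_index x, du_index x, du_index x) (du_point x)
  (conj (conj (du_memP x) (du_memP x)) (du_memP x)).
have := gE y; rewrite !associated_g1//.
have -> : face02 y = cech_unit x by exact: du_ext.
have -> : face01 y = cech_unit x by exact: du_ext.
have -> : face12 y = cech_unit x by exact: du_ext.
rewrite associated_lambda1 cm_act1 cm_actg1 lmul1g lmulg1.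
by move/esym/lmul_idem.
Qed.

(** The first coboundary equation, lambda'_ij r_j = rho(v_ij) r_i lambda_ij, with
    rho(v_ij) acting as conjugation by v_ij. *)
Lemma coboundary_intertwine a g :
  cm_act X (lam' a) (cm_act X (r (cech_tgt a)) g) =
  v a ** cm_act X (r (cech_src a)) (cm_act X (lam a) g) ** linv (v a).
Proof.
have [_ _ lE _] := coboundaryP.
by rewrite -(cm_peiffer X) -!cm_actM lE -!lmulA lmulVg lmulg1.
Qed.

Lemma iso_of_cochain_isomorphism :
  isomorphisms E E' (iso_of_cochain X (r, v)).
Proof.
have [sr sv lE gE] := coboundaryP.
have dPhi := diffeomorphism_Phi_of_cochain sr sv.
have dPsi := diffeomorphism_Psi_of_cochain v sr.
split.
- split=> //; last by move=> [g a]; rewrite !ad_phi.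
  split; first by case: dPhi.
  + by move=> [g a]; rewrite !ad_src.
  + by move=> [g a]; rewrite !ad_tgt.
  move=> [g a] [g' b]; rewrite ad_tgt ad_src /= => /composableP[y [-> ->]].
  rewrite !ad_gmulE /=; congr pair.
  have s02 : cech_src (face02 y) = vertex0 y by exact: du_ext.
  have s01 : cech_src (face01 y) = vertex0 y by exact: du_ext.
  have s12 : cech_src (face12 y) = cech_tgt (face01 y) by exact: du_ext.
  rewrite !cm_act_autM s12 coboundary_intertwine s02 s01 cm_actV.
  (* solve the second coboundary equation for the image of g_ijk under r_i *)
  set c := cm_act X (r (vertex0 y)) (gam y).
  have -> : c = linv (v (face01 y)) **
      linv (cm_act X (lam' (face01 y)) (v (face12 y))) ** gam' y ** v (face02 y).
    by rewrite -[RHS]lmulA gE -!lmulA !lmulKg.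
  by rewrite -!lmulA lmulgV lmulg1 lmulKg.
- by split=> // -[x h]; rewrite !ad_proj.
- move=> [g a] [x h] k; rewrite ad_tgt ad_proj /= => <-.
  rewrite !(ad_lact, ad_ract) /=; congr pair.
  rewrite -[(ext_lact E' _ _).2]/(lam' a) lE cm_rhoM cm_rhoV cm_rho_act.
  by rewrite -!lmulA !lmulKg.
- move=> [x h] g; rewrite !ad_chi /=; congr pair.
  by rewrite coboundary_v1 linv1 lmulg1 cech_src_cech_unit cm_actM.
Qed.

End Coboundary_to_isomorphism.

(** * The correspondence *)

Theorem proposition1p3p15 (R : realType) (N : manifold R) (I : choiceType)
    (U : open_cover N I) (G H : lie_group R) (X : crossed_module G H)
    (E E' : adapted_extension U X) :
  [/\ (* (1) is well defined *)
      forall F, isomorphisms E E' F ->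
        [/\ forall x, F.2 (x, lone H) = (x, (cochain_of_iso F).1 x),
            forall a, F.1 (lone G, a) = (linv ((cochain_of_iso F).2 a), a) &
            coboundary X (associated_cocycle E) (associated_cocycle E')
              (cochain_of_iso F)],
      (* (2) is well defined *)
      forall rv,
        coboundary X (associated_cocycle E) (associated_cocycle E') rv ->
        isomorphisms E E' (iso_of_cochain X rv),
      (* (1) and (2) are inverse to each other *)
      forall F, isomorphisms E E' F ->
        iso_of_cochain X (cochain_of_iso F) = F &
      forall rv,
        coboundary X (associated_cocycle E) (associated_cocycle E') rv ->
        cochain_of_iso (iso_of_cochain X rv) = rv].
Proof.
split.
- move=> F FP; split; [exact: iso_Psi1 FP|exact: iso_Phi1 FP|].
  split; [exact: smooth_r_of_iso FP|exact: smooth_v_of_iso FP| |].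
    exact: iso_coboundary_lambda FP.
  exact: iso_coboundary_g FP.
- by move=> [r v]; exact: iso_of_cochain_isomorphism.
- by move=> F; exact: cochain_of_isoK.
- move=> [r v] _; congr pair; apply/funext => x /=; first by rewrite lmulg1.
  by rewrite cm_actg1 lmul1g linvK.
Qed.
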